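(* There exists an absolute constant $0<C<\infty$ such that the following holds. For every $\varepsilon>0$ set $\delta(\varepsilon)=\exp(-C/\varepsilon^{21})>0$. Then for every $n\ge 1$ and all functions $f,g,h:\{-1,1\}^n\to\{-1,1\}$: if $$\mathbb{P}[f(x)=g(y)=h(z)]<\delta(\varepsilon),$$ then either two of the functions $f,g,h$ are $\varepsilon$-close to constant functions of opposite sign, or there exists a coordinate $i\in\{1,\dots,n\}$ such that $f,g$ and $h$ are all $\varepsilon$-close to the same dictator on voter $i$.
   Context: The random vectors $x=(x_1,\dots,x_n)$, $y=(y_1,\dots,y_n)$, $z=(z_1,\dots,z_n)$ in $\{-1,1\}^n$ are distributed as follows: the triples $(x_i,y_i,z_i)$, $1\le i\le n$, are independent, each uniform on the six-element set $\{-1,1\}^3\setminus\{(1,1,1),(-1,-1,-1)\}$. Two functions $u,v:\{-1,1\}^n\to\{-1,1\}$ are $\varepsilon$-close if $\mathbb{P}[u\neq v]\le\varepsilon$ under the uniform measure on $\{-1,1\}^n$. A dictator on voter $i$ is one of the two functions $x\mapsto x_i$ or $x\mapsto -x_i$. ''Constant functions of opposite sign'' means that one of the two functions is close to the constant $1$ and the other to the constant $-1$. *)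

(* Defs.v *)
From HB Require Import structures.
From mathcomp Require Import all_boot all_order all_algebra.
From mathcomp Require Import reals sequences exp.
Set Implicit Arguments.
Unset Strict Implicit.
Unset Printing Implicit Defensive.
Import Order.TTheory GRing.Theory Num.Theory.
Local Open Scope ring_scope.

(* The two-element set {-1,1} is [bool], with [true] for 1 and [false] for -1;
   negation of a sign is [~~]. *)
Definition cube (n : nat) : finType := {ffun 'I_n -> bool}.

Definition nae : {set bool * bool * bool} :=
  ~: [set (true, true, true); (false, false, false)].

Definition voter_pmf (R : realType) (t : bool * bool * bool) : R :=
  (t \in nae)%:R / #|nae|%:R.

(* Product over voters: the triples (x_i, y_i, z_i) are independent. *)
Definition profile_pmf (R : realType) (n : nat) (x y z : cube n) : R :=
  \prod_(i < n) voter_pmf R (x i, y i, z i).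

Definition profile_prob (R : realType) (n : nat)
    (E : cube n -> cube n -> cube n -> bool) : R :=
  \sum_(x : cube n) \sum_(y : cube n) \sum_(z : cube n | E x y z)
     profile_pmf R x y z.

Definition unif_prob (R : realType) (n : nat) (E : pred (cube n)) : R :=
  #|[set x : cube n | E x]|%:R / #|cube n|%:R.

Definition close (R : realType) (n : nat) (eps : R) (u v : cube n -> bool) :
    Prop :=
  unif_prob R (fun x => u x != v x) <= eps.

Definition is_dictator (n : nat) (i : 'I_n) (u : cube n -> bool) : Prop :=
  u = (fun x => x i) \/ u = (fun x => ~~ x i).

Definition close_to_opposite_constants (R : realType) (n : nat) (eps : R)
    (u v : cube n -> bool) : Prop :=
  exists c : bool, close eps u (fun=> c) /\ close eps v (fun=> ~~ c).

(* Main.v *)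
Require Import Defs.
From HB Require Import structures.
From mathcomp Require Import all_boot all_order all_algebra.
From mathcomp Require Import ring lra.
From mathcomp Require Import reals sequences exp.
Set Implicit Arguments.
Unset Strict Implicit.
Unset Printing Implicit Defensive.
Import Order.TTheory GRing.Theory Num.Theory.
Local Open Scope ring_scope.

(* Reveal the voters one at a time and let a_t, b_t, c_t be the conditional
   probabilities of three events {f(x) = v}, {g(y) = v}, {h(z) = v}.
   - The product a_t^2 b_t^2 is a submartingale, so two events of measures a, b
     on x and y meet with probability at least a^2 b^2.  Applied to pivotality,
     this shows that voters i <> j influential for f and g respectively produce
     f = g = h with noticeable probability: condition on both being pivotal and
     steer f and g towards the value of h.
   - The product (a_t b_t c_t)^4 loses in expectation only at steps where the
     relative jumps of all three factors are large, and then at most a constant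
     times the product of the squared increments of b_t and c_t.  If g and h have
     small influences, hypercontractivity makes the sum of these losses small;
     hence f = g = h = v is likely unless one of the events is rare.
   By the first point, some voter i is such that two of the functions have small
   influences off i.  Fixing the votes of i and applying the second point to the
   restricted functions, for each of the six votes of i and both values v, leaves
   a finite problem about one voter.  Altogether P[f = g = h] is bounded below by
   a power of eps, which beats exp(-C / eps^21). *)

(** * One-step inequalities *)

Definition nae_mean (R : realFieldType) (F : bool -> bool -> bool -> R) : R :=
  (F true true false + F true false true + F true false false +
   F false true true + F false true false + F false false true) / 6.

Definition jump (R : realFieldType) (a d : R) (s : bool) : R :=
  if s then a + d else a - d.

(** Two votes of one voter have correlation -1/3, so the difference of the two sides is [a^2 e^2 +
    d^2 b^2 + d^2 e^2 - (4/3) a d b e]; AM-GM absorbs the cross term. *)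
Lemma nae_mean_sqr (R : realFieldType) (a d b e : R) :
  a ^+ 2 * b ^+ 2 <=
  nae_mean (fun s t _ => jump a d s ^+ 2 * jump b e t ^+ 2).
Proof.
rewrite /nae_mean /jump.
have h1 := sqr_ge0 (a * e - d * b); have h2 := sqr_ge0 (a * e).
have h3 := sqr_ge0 (d * b); have h4 := sqr_ge0 (d * e).
rewrite -subr_ge0; lra.
Qed.

(* [(1 + s * u) ^+ 4 = even4 u + s * odd4 u] for a sign [s]. *)
Definition even4 (R : realFieldType) (u : R) : R := 1 + 6 * u ^+ 2 + u ^+ 4.
Definition odd4 (R : realFieldType) (u : R) : R := 4 * (u + u ^+ 3).

(** Pairs of votes have correlation -1/3, while single votes and the product of all three have mean
    zero by symmetry under a global sign change. *)
Lemma nae_mean_pow4 (R : realFieldType) (u v w : R) :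
  nae_mean (fun s t r => jump 1 u s ^+ 4 * jump 1 v t ^+ 4 * jump 1 w r ^+ 4) =
  even4 u * even4 v * even4 w -
  (even4 u * odd4 v * odd4 w + even4 v * odd4 u * odd4 w +
   even4 w * odd4 u * odd4 v) / 3.
Proof. by rewrite /nae_mean /jump /even4 /odd4; field. Qed.

(* Together with [even4 w >= 1 + 6 w^2] and [odd4 w <= (104/25) w], the second
   bound makes the discriminant in [nae_pow4_small] nonpositive:
   [(104/25)^2 / 24 < 3/4]. *)
Lemma pair_pow4 (R : realFieldType) (u v : R) : 0 <= u <= 1 -> 0 <= v <= 1 ->
  let A := even4 u * even4 v - odd4 u * odd4 v / 3 in
  let B := (even4 u * odd4 v + even4 v * odd4 u) / 3 in
  1 <= A /\ 3 / 4 * B ^+ 2 <= A * (A - 1).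
Proof.
move=> /andP[u0 u1] /andP[v0 v1] A B.
(* [A] and [B^2] are symmetric in [u], [v] and even under a joint sign change, hence polynomials in
   [p] and [e]. *)
pose p := u * v; pose e := (u - v) ^+ 2.
have p0 : 0 <= p by rewrite mulr_ge0.
have e0 : 0 <= e by rewrite sqr_ge0.
have AE : A = 1 + 20 / 3 * p + 6 * e + 82 / 3 * p ^+ 2 - 4 / 3 * (p * e)
             + e ^+ 2 + 20 / 3 * p ^+ 3 + 6 * (p ^+ 2 * e) + p ^+ 4.
  by rewrite /A /even4 /odd4 /p /e; field.
have Age1 : 1 <= A.
  rewrite AE.
  have h1 : 0 <= p ^+ 3 by rewrite exprn_ge0.
  have h2 : 0 <= p ^+ 4 by rewrite exprn_ge0.
  have h3 : 0 <= p ^+ 2 * e by rewrite mulr_ge0 // sqr_ge0.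
  have h4 := sqr_ge0 (e - p).
  have h5 := sqr_ge0 p.
  have h6 : (e - p) ^+ 2 = e ^+ 2 - 2 * (p * e) + p ^+ 2 by ring.
  have h7 := sqr_ge0 e.
  lra.
split => //.
rewrite -subr_ge0.
(* Sorted by powers of [e], every coefficient is nonnegative for [p >= 0]; the squares in [Q0],
   [Q1], [Q2] absorb the negative terms. *)
have -> : A * (A - 1) - 3 / 4 * B ^+ 2 =
    (4 / 3 * p - 26 / 9 * p ^+ 2 + 316 / 9 * p ^+ 3 + p ^+ 4 * (911 / 3
      + 376 / 9 * p + 220 / 9 * p ^+ 2 + 8 * p ^+ 3 + p ^+ 4))
  + e * (14 / 3 + 148 / 3 * p + 1322 / 9 * p ^+ 2 - 1760 / 9 * p ^+ 3
     + 1376 / 9 * p ^+ 4 + 48 * p ^+ 5 + 32 / 3 * p ^+ 6)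
  + e ^+ 2 * (103 / 3 - 88 / 3 * p + 724 / 9 * p ^+ 2 - 88 / 3 * p ^+ 3
     + 106 / 3 * p ^+ 4)
  + e ^+ 3 * (32 / 3 - 16 / 3 * p + 32 / 3 * p ^+ 2) + e ^+ 4.
  by rewrite AE /B /even4 /odd4 /p /e; field.
have P2 := sqr_ge0 p.
have P3 : 0 <= p ^+ 3 by rewrite exprn_ge0.
have P4 : 0 <= p ^+ 4 by rewrite exprn_ge0.
have P5 : 0 <= p ^+ 5 by rewrite exprn_ge0.
have P6 : 0 <= p ^+ 6 by rewrite exprn_ge0.
have Q0 : 0 <= p * (1 - 3 * p) ^+ 2 by rewrite mulr_ge0 ?sqr_ge0.
have Q0' : p * (1 - 3 * p) ^+ 2 = p - 6 * p ^+ 2 + 9 * p ^+ 3 by ring.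
have Q1 : 0 <= (1 - p) ^+ 2 by rewrite sqr_ge0.
have Q1' : (1 - p) ^+ 2 = 1 - 2 * p + p ^+ 2 by ring.
have Q2 : 0 <= p ^+ 2 * (1 - p) ^+ 2 by rewrite mulr_ge0 ?sqr_ge0.
have Q2' : p ^+ 2 * (1 - p) ^+ 2 = p ^+ 2 - 2 * p ^+ 3 + p ^+ 4 by ring.
apply: addr_ge0; last by rewrite exprn_ge0.
apply: addr_ge0; last by apply: mulr_ge0; [rewrite exprn_ge0|lra].
apply: addr_ge0; last by apply: mulr_ge0; [rewrite sqr_ge0|lra].
apply: addr_ge0; last by apply: mulr_ge0 => //; lra.
have h : 0 <= p ^+ 4 * (911 / 3 + 376 / 9 * p + 220 / 9 * p ^+ 2
    + 8 * p ^+ 3 + p ^+ 4) by apply: mulr_ge0 => //; lra.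
lra.
Qed.

(** The right-hand side is [even4 w * A - odd4 w * B] with [A], [B] from [pair_pow4]; for [w <= 1/5]
    it is bounded below by a quadratic in [w]. *)
Lemma nae_pow4_small (R : realFieldType) (u v w : R) :
  0 <= u <= 1 -> 0 <= v <= 1 -> 0 <= w <= 1 / 5 ->
  1 <= even4 u * even4 v * even4 w -
       (even4 u * odd4 v * odd4 w + even4 v * odd4 u * odd4 w +
        even4 w * odd4 u * odd4 v) / 3.
Proof.
move=> hu hv /andP[w0 w1].
have [A1 AB] := pair_pow4 hu hv.
set A := _ - _ in A1 AB; set B := _ / 3 in AB.
have B0 : 0 <= B.
  move: hu hv => /andP[u0 _] /andP[v0 _].
  by rewrite /B /even4 /odd4 divr_ge0 // !(addr_ge0, mulr_ge0, exprn_ge0).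
have -> : even4 u * even4 v * even4 w -
       (even4 u * odd4 v * odd4 w + even4 v * odd4 u * odd4 w +
        even4 w * odd4 u * odd4 v) / 3 = even4 w * A - odd4 w * B.
  by rewrite /A /B; field.
have Zle : odd4 w <= 104 / 25 * w.
  have h : w ^+ 2 <= (1 / 5) ^+ 2 by rewrite ler_pXn2r ?nnegrE //; lra.
  have : w * w ^+ 2 <= w * (1 / 5) ^+ 2 by rewrite ler_wpM2l.
  by rewrite /odd4 exprS; lra.
have Wge : 1 + 6 * w ^+ 2 <= even4 w by rewrite /even4 lerDl exprn_ge0.
have h1 : odd4 w * B <= 104 / 25 * w * B by rewrite ler_wpM2r.
have h2 : (1 + 6 * w ^+ 2) * A <= even4 w * A by rewrite ler_wpM2r //; lra.
(* The factor [A] allows completing the square in [w * A]; [26/75] is [(104/25) / 12]. *)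
suff : 0 <= A * (A + 6 * w ^+ 2 * A - 104 / 25 * w * B - 1).
  rewrite pmulr_rge0; lra.
have h3 : 0 <= 6 * (w * A - 26 / 75 * B) ^+ 2 by rewrite mulr_ge0 ?sqr_ge0.
have h4 := sqr_ge0 B.
have -> : A * (A + 6 * w ^+ 2 * A - 104 / 25 * w * B - 1)
  = A * (A - 1) + 6 * (w * A - 26 / 75 * B) ^+ 2 - 6 * (26 / 75) ^+ 2 * B ^+ 2
  by field.
lra.
Qed.

Lemma nae_mean_ge0 (R : realFieldType) (F : bool -> bool -> bool -> R) :
  (forall s t r, 0 <= F s t r) -> 0 <= nae_mean F.
Proof. by move=> F0; rewrite /nae_mean divr_ge0 // !addr_ge0. Qed.

(* A small jump in one factor costs nothing; if [|v|, |w| > 1/5] the left-hand side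
   is negative, whence [625 = 5^4]. *)
Lemma nae_mean_pow4_ge (R : realFieldType) (u v w : R) :
  `|u| <= 1 -> `|v| <= 1 -> `|w| <= 1 ->
  1 - 625 * (v ^+ 2 * w ^+ 2) <=
  nae_mean (fun s t r => jump 1 u s ^+ 4 * jump 1 v t ^+ 4 * jump 1 w r ^+ 4).
Proof.
move=> u1 v1 w1.
have even4_abs (t : R) : even4 `|t| = even4 t.
  by rewrite /even4 !real_normK ?num_real // (exprM _ 2 2) real_normK ?num_real // -exprM.
have even4_ge0 (t : R) : 0 <= even4 t.
  by rewrite -even4_abs /even4 !(addr_ge0, mulr_ge0, exprn_ge0).
have odd4_abs (t : R) : `|odd4 t| = odd4 `|t|.
  have odd4_ge0 (x : R) : 0 <= x -> 0 <= odd4 x.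
    by move=> x0; rewrite /odd4 mulr_ge0 // addr_ge0 ?exprn_ge0.
  have [t0|t0] := leP 0 t; first by rewrite !ger0_norm // odd4_ge0.
  have tN : 0 <= - t by rewrite oppr_ge0 ltW.
  have -> : odd4 t = - odd4 (- t) by rewrite /odd4; ring.
  by rewrite normrN (ltr0_norm t0) ger0_norm ?odd4_ge0.
(* Passing to absolute values keeps the even factors and can only increase the odd products that are
   subtracted. *)
have small (a b c : R) : `|a| <= 1 -> `|b| <= 1 -> `|c| <= 1 / 5 ->
    1 <= even4 a * even4 b * even4 c - (even4 a * odd4 b * odd4 c +
      even4 b * odd4 a * odd4 c + even4 c * odd4 a * odd4 b) / 3.
  move=> a1 b1 c1.
  have := @nae_pow4_small R `|a| `|b| `|c|.
  rewrite !normr_ge0 a1 b1 c1 !even4_abs -!odd4_abs => /(_ isT isT isT).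
  have h (x y z : R) : 0 <= x -> x * y * z <= x * `|y| * `|z|.
    by move=> x0; rewrite -!mulrA ler_wpM2l // -normrM ler_norm.
  have h1 := h _ (odd4 b) (odd4 c) (even4_ge0 a).
  have h2 := h _ (odd4 a) (odd4 c) (even4_ge0 b).
  have h3 := h _ (odd4 a) (odd4 b) (even4_ge0 c).
  lra.
have vw0 : 0 <= v ^+ 2 * w ^+ 2 by rewrite mulr_ge0 ?sqr_ge0.
have [w5|w5] := leP `|w| (1 / 5).
  by rewrite nae_mean_pow4; have := small u v w u1 v1 w5; lra.
have [v5|v5] := leP `|v| (1 / 5).
  by rewrite nae_mean_pow4; have := small u w v u1 w1 v5; lra.
have sq (t : R) : 1 / 5 < `|t| -> 1 / 25 <= t ^+ 2.
  move=> t5; rewrite -(real_normK (num_real t)).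
  have -> : 1 / 25 = (1 / 5) ^+ 2 :> R by field.
  by rewrite ler_pXn2r ?nnegrE //; lra.
have : 1 / 25 * (1 / 25) <= v ^+ 2 * w ^+ 2.
  by apply: ler_pM; rewrite ?sq //; lra.
have : 0 <= nae_mean (fun s t r =>
    jump 1 u s ^+ 4 * jump 1 v t ^+ 4 * jump 1 w r ^+ 4).
  apply: nae_mean_ge0 => s t r.
  by apply: mulr_ge0; [apply: mulr_ge0|]; exact: exprn_even_ge0.
lra.
Qed.

(** Homogeneous form of [nae_mean_pow4_ge], applied to the relative jumps [d / a], [e / b], [f / c].
    Rescaling multiplies the loss by [a^4 b^2 c^2 <= 1]; if some factor vanishes, the left-hand side
    is at most zero. *)
Lemma nae_mean_pow4_loss (R : realFieldType) (a b c d e f : R) :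
  `|d| <= a <= 1 -> `|e| <= b <= 1 -> `|f| <= c <= 1 ->
  (a * b * c) ^+ 4 - 625 * (e ^+ 2 * f ^+ 2) <=
  nae_mean (fun s t r => (jump a d s * jump b e t * jump c f r) ^+ 4).
Proof.
move=> /andP[da a1] /andP[eb b1] /andP[fc c1].
have a0 : 0 <= a by exact: le_trans da.
have b0 : 0 <= b by exact: le_trans eb.
have c0 : 0 <= c by exact: le_trans fc.
have [abc0|abc_neq0] := eqVneq (a * b * c) 0.
  rewrite abc0 expr0n /= sub0r.
  apply: (@le_trans _ _ 0).
    by rewrite oppr_le0 pmulr_rge0 // mulr_ge0 ?sqr_ge0.
  by apply: nae_mean_ge0 => s t r; rewrite exprn_even_ge0.
move: abc_neq0; rewrite !mulf_eq0 !negb_or => /andP[/andP[an0 bn0] cn0].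
have le1 (x y : R) : `|x| <= y -> y != 0 -> `|x / y| <= 1.
  move=> xy yn0; have y0 : 0 < y by rewrite lt_neqAle eq_sym yn0 (le_trans _ xy).
  by rewrite normrM normfV (gtr0_norm y0) ler_pdivrMr // mul1r.
have := nae_mean_pow4_ge (le1 _ _ da an0) (le1 _ _ eb bn0) (le1 _ _ fc cn0).
set N := nae_mean _ => hN.
have -> : nae_mean (fun s t r => (jump a d s * jump b e t * jump c f r) ^+ 4) =
    (a * b * c) ^+ 4 * N.
  by rewrite /N /nae_mean /jump; field; rewrite an0 bn0 cn0.
have h : (a * b * c) ^+ 4 * ((e / b) ^+ 2 * (f / c) ^+ 2) <= e ^+ 2 * f ^+ 2.
  have -> : (a * b * c) ^+ 4 * ((e / b) ^+ 2 * (f / c) ^+ 2) =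
      (a ^+ 4 * b ^+ 2 * c ^+ 2) * (e ^+ 2 * f ^+ 2).
    by field; rewrite bn0 cn0.
  apply: ler_piMl; first by rewrite mulr_ge0 ?sqr_ge0.
  have i1 (x : R) k : 0 <= x -> x <= 1 -> 0 <= x ^+ k <= 1.
    by move=> *; rewrite exprn_ge0 ?exprn_ile1.
  have /andP[A0 A1] := i1 _ 4%N a0 a1; have /andP[B0 B1] := i1 _ 2%N b0 b1.
  have /andP[C0 C1] := i1 _ 2%N c0 c1.
  by apply: mulr_ile1 => //; [exact: mulr_ge0|exact: mulr_ile1].
have : (a * b * c) ^+ 4 * (1 - 625 * ((e / b) ^+ 2 * (f / c) ^+ 2)) <=
    (a * b * c) ^+ 4 * N by rewrite ler_wpM2l // exprn_ge0 // !mulr_ge0.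
lra.
Qed.

(** One-voter case of hypercontractivity: [P] and [Q] are the [L^3] norms of [p] and [q] on a
    uniform bit. *)
Lemma nae_mean_cube_le (R : realFieldType) (p q : bool -> R) (P Q : R) :
  (forall s, 0 <= p s) -> (forall s, 0 <= q s) -> 0 <= P -> 0 <= Q ->
  P ^+ 3 = (p true ^+ 3 + p false ^+ 3) / 2 ->
  Q ^+ 3 = (q true ^+ 3 + q false ^+ 3) / 2 ->
  nae_mean (fun _ t r => p t ^+ 2 * q r ^+ 2) <= P ^+ 2 * Q ^+ 2.
Proof.
(* Here [m^2 + d^2] is the mean of [x^2] and [2 m d] its half-difference; the weight [4/3] is that
   of the cross term produced by the correlation -1/3. *)
have key (x : bool -> R) (X : R) : (forall s, 0 <= x s) -> 0 <= X ->
    X ^+ 3 = (x true ^+ 3 + x false ^+ 3) / 2 ->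
    let m := (x true + x false) / 2 in let d := (x true - x false) / 2 in
    (m ^+ 2 + d ^+ 2) ^+ 2 + 4 / 3 * (m * d) ^+ 2 <= X ^+ 4.
  move=> x0 X0 XE; set m := _ / 2; set d := _ / 2; cbv zeta.
  have m0 : 0 <= m by rewrite divr_ge0 // addr_ge0.
  have dm : d ^+ 2 <= m ^+ 2.
    rewrite -subr_ge0.
    have -> : m ^+ 2 - d ^+ 2 = x true * x false by rewrite /m /d; field.
    by rewrite mulr_ge0.
  have XE' : X ^+ 3 = m * (m ^+ 2 + 3 * d ^+ 2) by rewrite XE /m /d; field.
  set M := m ^+ 2 in dm *; set D := d ^+ 2 in dm XE' *.
  have M0 : 0 <= M by rewrite sqr_ge0.
  have D0 : 0 <= D by rewrite sqr_ge0.
  (* Only [X^3] is a polynomial in [m] and [d], so both sides are cubed to turn [X^4] into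
     [(X^3)^4]. *)
  rewrite -(@ler_pXn2r _ 3) ?nnegrE ?exprn_ge0 //; last first.
    by apply: addr_ge0; [|apply: mulr_ge0]; rewrite ?sqr_ge0 ?divr_ge0.
  have -> : X ^+ 4 ^+ 3 = (X ^+ 3) ^+ 4 by ring.
  have -> : (m * d) ^+ 2 = M * D by rewrite /M /D; ring.
  have -> : (X ^+ 3) ^+ 4 = M ^+ 2 * (M + 3 * D) ^+ 4.
    by rewrite XE' /M; ring.
  rewrite -subr_ge0.
  have -> : M ^+ 2 * (M + 3 * D) ^+ 4 - ((M + D) ^+ 2 + 4 / 3 * (M * D)) ^+ 3 =
     2 * (M ^+ 5 * D) + 53 / 3 * (M ^+ 4 * D ^+ 2) +
     1376 / 27 * (M ^+ 3 * D ^+ 3) + D ^+ 4 * (101 / 3 * M ^+ 2 + 10 * (M ^+ 2 - M * D)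
      + (M ^+ 2 - D ^+ 2)).
    by field.
  have MD : 0 <= M ^+ 2 - M * D by rewrite subr_ge0 expr2 ler_wpM2l.
  have DD : 0 <= M ^+ 2 - D ^+ 2 by rewrite subr_ge0 ler_pXn2r.
  have T0 : 0 <= D ^+ 4 * (101 / 3 * M ^+ 2 + 10 * (M ^+ 2 - M * D) +
      (M ^+ 2 - D ^+ 2)).
    by have M2 := sqr_ge0 M; apply: mulr_ge0; [rewrite exprn_ge0|lra].
  have T1 : 0 <= M ^+ 5 * D by rewrite mulr_ge0 // exprn_ge0.
  have T2 : 0 <= M ^+ 4 * D ^+ 2 by apply: mulr_ge0; exact: exprn_ge0.
  have T3 : 0 <= M ^+ 3 * D ^+ 3 by apply: mulr_ge0; exact: exprn_ge0.
  by rewrite addr_ge0 //; lra.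
move=> p0 q0 P0 Q0 PE QE.
have hP := key p P p0 P0 PE; have hQ := key q Q q0 Q0 QE.
have L0 : 0 <= nae_mean (fun _ t r => p t ^+ 2 * q r ^+ 2).
  by apply: nae_mean_ge0 => _ t r; apply: mulr_ge0; exact: sqr_ge0.
have R0 : 0 <= P ^+ 2 * Q ^+ 2 by apply: mulr_ge0; exact: sqr_ge0.
rewrite -(@ler_pXn2r _ 2) ?nnegrE //.
have -> : (P ^+ 2 * Q ^+ 2) ^+ 2 = P ^+ 4 * Q ^+ 4 by ring.
move: hP hQ => /=; set m := _ / 2; set d := _ / 2; set k := _ / 2; set e := _ / 2.
move=> hP hQ; apply: le_trans (ler_pM _ _ hP hQ); last 2 first.
- by apply: addr_ge0; [|apply: mulr_ge0]; rewrite ?sqr_ge0 ?divr_ge0.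
- by apply: addr_ge0; [|apply: mulr_ge0]; rewrite ?sqr_ge0 ?divr_ge0.
have -> : nae_mean (fun _ t r => p t ^+ 2 * q r ^+ 2) =
    (m ^+ 2 + d ^+ 2) * (k ^+ 2 + e ^+ 2) - 4 / 3 * (m * d) * (k * e).
  by rewrite /nae_mean /m /d /k /e; field.
(* Cauchy-Schwarz decouples [p] from [q], and [key] bounds each factor. *)
have := sqr_ge0 ((m ^+ 2 + d ^+ 2) * (k * e) + (k ^+ 2 + e ^+ 2) * (m * d)).
rewrite -subr_ge0 => h.
rewrite -subr_ge0; lra.
Qed.

(** * Expectations on the cube and on profiles *)

Definition upd (T : Type) (n : nat) (w : {ffun 'I_n -> T}) (i : 'I_n) (a : T) :
    {ffun 'I_n -> T} := [ffun j => if j == i then a else w j].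

Lemma upd_eq (T : Type) (n : nat) (w : {ffun 'I_n -> T}) i a : upd w i a i = a.
Proof. by rewrite ffunE eqxx. Qed.

Lemma upd_neq (T : Type) (n : nat) (w : {ffun 'I_n -> T}) i j a :
  j != i -> upd w i a j = w j.
Proof. by move=> /negPf ji; rewrite ffunE ji. Qed.

Lemma upd_upd (T : Type) (n : nat) (w : {ffun 'I_n -> T}) i a b :
  upd (upd w i a) i b = upd w i b.
Proof. by apply/ffunP => j; rewrite !ffunE; case: eqP. Qed.

Lemma upd_id (T : Type) (n : nat) (w : {ffun 'I_n -> T}) i : upd w i (w i) = w.
Proof. by apply/ffunP => j; rewrite !ffunE; case: eqP => [->|]. Qed.

Lemma updC (T : Type) (n : nat) (w : {ffun 'I_n -> T}) i j a b : i != j ->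
  upd (upd w i a) j b = upd (upd w j b) i a.
Proof.
move=> ij; apply/ffunP => k; rewrite !ffunE.
by case: (eqVneq k j) => [->|//]; rewrite eq_sym (negPf ij).
Qed.

Definition prod_mean (R : realFieldType) (T : finType) (p : T -> R) (n : nat)
    (F : {ffun 'I_n -> T} -> R) : R :=
  \sum_(w : {ffun 'I_n -> T}) (\prod_(i < n) p (w i)) * F w.

(** Exchanging coordinate [i] with an independent fresh draw is an involution that preserves the
    product weight. *)
Lemma prod_mean_resample (R : realFieldType) (T : finType) (p : T -> R)
    (n : nat) (i : 'I_n) (F : {ffun 'I_n -> T} -> R) : \sum_a p a = 1 ->
  prod_mean p F = prod_mean p (fun w => \sum_a p a * F (upd w i a)).
Proof.
move=> p1; rewrite /prod_mean.
pose h (u : {ffun 'I_n -> T} * T) := (upd u.1 i u.2, u.1 i).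
have hK : involutive h by case=> w a; rewrite /h /= upd_upd upd_id upd_eq.
under [RHS]eq_bigr do rewrite mulr_sumr.
rewrite pair_bigA /= (reindex_inj (inv_inj hK)) /=.
transitivity (\sum_(w : {ffun 'I_n -> T}) \sum_a
    (\prod_(j < n) p (w j)) * (p a * F w)).
  apply: eq_bigr => w _.
  by rewrite -mulr_sumr -mulr_suml p1 mul1r.
rewrite pair_bigA /=; apply: eq_bigr => -[w a] _ /=.
rewrite upd_upd upd_id !mulrA; congr (_ * _).
rewrite (bigD1 i) //= [in RHS](bigD1 i) //= upd_eq.
have -> : \prod_(j < n | j != i) p (upd w i a j) = \prod_(j < n | j != i) p (w j).
  by apply: eq_bigr => j ji; rewrite upd_neq.
ring.
Qed.

Lemma prod_mean_cst (R : realFieldType) (T : finType) (p : T -> R) (n : nat)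
    (c : R) : \sum_a p a = 1 ->
  prod_mean p (fun _ : {ffun 'I_n -> T} => c) = c.
Proof.
move=> p1; rewrite /prod_mean -mulr_suml.
rewrite -(bigA_distr_bigA (fun (_ : 'I_n) a => p a)) /=.
by rewrite big1 ?mul1r // => i _.
Qed.

Lemma le_prod_mean (R : realFieldType) (T : finType) (p : T -> R) (n : nat)
    (F G : {ffun 'I_n -> T} -> R) : (forall a, 0 <= p a) ->
  (forall w, F w <= G w) -> prod_mean p F <= prod_mean p G.
Proof.
move=> p0 FG; apply: ler_sum => w _; apply: ler_wpM2l => //.
exact: prodr_ge0.
Qed.

(** The uniform mean is written as a product mean so that it shares [prod_mean_resample] with the
    profile measure. *)
Definition cube_mean (R : realFieldType) (n : nat) (F : cube n -> R) : R :=
  prod_mean (fun _ : bool => 2^-1) F.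

Lemma half_sum1 (R : realFieldType) : \sum_(a : bool) (2^-1 : R) = 1.
Proof. by rewrite big_bool /=; field. Qed.

Lemma cube_mean_resample (R : realFieldType) (n : nat) (i : 'I_n)
    (F : cube n -> R) :
  cube_mean F = cube_mean (fun x => (F (upd x i true) + F (upd x i false)) / 2).
Proof.
rewrite /cube_mean (prod_mean_resample i) ?half_sum1 //.
by apply: eq_bigr => x _; rewrite big_bool /= mulrDl ![_ / 2]mulrC.
Qed.

Lemma cube_mean_cst (R : realFieldType) (n : nat) (c : R) :
  cube_mean (fun _ : cube n => c) = c.
Proof. by rewrite /cube_mean prod_mean_cst // half_sum1. Qed.

Lemma le_cube_mean (R : realFieldType) (n : nat) (F G : cube n -> R) :
  (forall x, F x <= G x) -> cube_mean F <= cube_mean G.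
Proof. by apply: le_prod_mean => _; rewrite invr_ge0. Qed.

Lemma cube_mean_ge0 (R : realFieldType) (n : nat) (F : cube n -> R) :
  (forall x, 0 <= F x) -> 0 <= cube_mean F.
Proof. by move=> F0; rewrite -(cube_mean_cst n (0 : R)) le_cube_mean. Qed.

Lemma eq_cube_mean (R : realFieldType) (n : nat) (F G : cube n -> R) :
  F =1 G -> cube_mean F = cube_mean G.
Proof. by move=> FG; apply: eq_bigr => x _; rewrite FG. Qed.

Lemma cube_meanD (R : realFieldType) (n : nat) (F G : cube n -> R) :
  cube_mean (fun x => F x + G x) = cube_mean F + cube_mean G.
Proof. by rewrite -big_split; apply: eq_bigr => x _; rewrite mulrDr. Qed.

Lemma cube_meanZ (R : realFieldType) (n : nat) (c : R) (F : cube n -> R) :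
  cube_mean (fun x => c * F x) = c * cube_mean F.
Proof. by rewrite mulr_sumr; apply: eq_bigr => x _; rewrite mulrCA. Qed.

Lemma cube_meanB (R : realFieldType) (n : nat) (F G : cube n -> R) :
  cube_mean (fun x => F x - G x) = cube_mean F - cube_mean G.
Proof.
rewrite cube_meanD; congr (_ + _); rewrite -mulN1r -cube_meanZ.
by apply: eq_cube_mean => x; rewrite mulN1r.
Qed.

Definition nae_prob_mean (R : realType) (n : nat)
    (F : cube n -> cube n -> cube n -> R) : R :=
  \sum_(x : cube n) \sum_(y : cube n) \sum_(z : cube n)
    profile_pmf R x y z * F x y z.

Lemma card_nae : #|nae| = 6%N.
Proof.
rewrite /nae cardsCs setCK cards2 /= !card_prod !card_bool.
by [].
Qed.

Lemma voter_pmf_sum (R : realType) (F : bool * bool * bool -> R) :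
  \sum_a voter_pmf R a * F a = nae_mean (fun s t r => F (s, t, r)).
Proof.
pose G a := voter_pmf R a * F a.
transitivity (\sum_(a : bool * bool * bool) G (a.1.1, a.1.2, a.2)).
  by apply: eq_bigr => -[[s t] r].
rewrite -(pair_bigA _ (fun st r => G (st.1, st.2, r))) /=.
rewrite -(pair_bigA _ (fun s t => \sum_r G (s, t, r))) /G /=.
rewrite !big_bool /= /voter_pmf !inE /= card_nae /nae_mean /=.
by field.
Qed.

(** A triple of vectors is re-encoded as a vector of triples, over which the measure is a
    product. *)
Lemma nae_prob_meanE (R : realType) (n : nat)
    (F : cube n -> cube n -> cube n -> R) :
  nae_prob_mean F = prod_mean (voter_pmf R) (fun w : {ffun 'I_n -> _} =>
    F [ffun i => (w i).1.1] [ffun i => (w i).1.2] [ffun i => (w i).2]).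
Proof.
pose m (u : cube n * cube n * cube n) : {ffun 'I_n -> bool * bool * bool} :=
  [ffun i => (u.1.1 i, u.1.2 i, u.2 i)].
pose m' (w : {ffun 'I_n -> bool * bool * bool}) : cube n * cube n * cube n :=
  ([ffun i => (w i).1.1], [ffun i => (w i).1.2], [ffun i => (w i).2]).
have mK : cancel m m'.
  move=> [[x y] z]; congr (_, _, _); apply/ffunP => i; by rewrite !ffunE.
have m'K : cancel m' m.
  by move=> w; apply/ffunP => i; rewrite !ffunE /=; case: (w i) => [[]].
rewrite /prod_mean (reindex m) /=; last by exists m' => u _.
rewrite /nae_prob_mean pair_bigA pair_bigA /=.
apply: eq_bigr => -[[x y] z] _ /=.
have [-> -> ->] := mK (x, y, z).
by congr (_ * _); apply: eq_bigr => i _; rewrite ffunE.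
Qed.

Lemma voter_pmf_sum1 (R : realType) : \sum_a voter_pmf R a = 1.
Proof.
have := voter_pmf_sum (fun _ => 1 : R).
under eq_bigr do rewrite mulr1.
by move=> ->; rewrite /nae_mean; field.
Qed.

Lemma voter_pmf_ge0 (R : realType) a : 0 <= voter_pmf R a.
Proof. by rewrite /voter_pmf divr_ge0. Qed.

Lemma nae_prob_mean_resample (R : realType) (n : nat) (i : 'I_n)
    (F : cube n -> cube n -> cube n -> R) :
  nae_prob_mean F = nae_prob_mean (fun x y z =>
    nae_mean (fun s t r => F (upd x i s) (upd y i t) (upd z i r))).
Proof.
rewrite !nae_prob_meanE (prod_mean_resample i) ?voter_pmf_sum1 //.
apply: eq_bigr => w _; rewrite voter_pmf_sum; congr (_ * _).
have updE (S : Type) (q : bool * bool * bool -> S) a :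
    [ffun j => q (upd w i a j)] = upd [ffun j => q (w j)] i (q a).
  by apply/ffunP => j; rewrite !ffunE; case: eqP.
by rewrite /nae_mean !(updE _ (fun t => t.1.1)) !(updE _ (fun t => t.1.2))
  !(updE _ (fun t => t.2)).
Qed.

Lemma le_nae_prob_mean (R : realType) (n : nat)
    (F G : cube n -> cube n -> cube n -> R) :
  (forall x y z, F x y z <= G x y z) -> nae_prob_mean F <= nae_prob_mean G.
Proof.
move=> FG; rewrite !nae_prob_meanE; apply: le_prod_mean => // a.
exact: voter_pmf_ge0.
Qed.

Lemma nae_prob_mean_cst (R : realType) (n : nat) (c : R) :
  nae_prob_mean (fun _ _ _ : cube n => c) = c.
Proof. by rewrite nae_prob_meanE prod_mean_cst // voter_pmf_sum1. Qed.

Lemma eq_nae_prob_mean (R : realType) (n : nat)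
    (F G : cube n -> cube n -> cube n -> R) :
  (forall x y z, F x y z = G x y z) -> nae_prob_mean F = nae_prob_mean G.
Proof.
by move=> FG; do 3!(apply: eq_bigr => ? _); rewrite FG.
Qed.

Lemma nae_prob_meanD (R : realType) (n : nat)
    (F G : cube n -> cube n -> cube n -> R) :
  nae_prob_mean (fun x y z => F x y z + G x y z) =
  nae_prob_mean F + nae_prob_mean G.
Proof.
rewrite !nae_prob_meanE -big_split; apply: eq_bigr => x _.
by rewrite mulrDr.
Qed.

Lemma nae_prob_meanZ (R : realType) (n : nat) (c : R)
    (F : cube n -> cube n -> cube n -> R) :
  nae_prob_mean (fun x y z => c * F x y z) = c * nae_prob_mean F.
Proof.
by rewrite !nae_prob_meanE mulr_sumr; apply: eq_bigr => x _; rewrite mulrCA.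
Qed.

Lemma nae_prob_meanB (R : realType) (n : nat)
    (F G : cube n -> cube n -> cube n -> R) :
  nae_prob_mean (fun x y z => F x y z - G x y z) =
  nae_prob_mean F - nae_prob_mean G.
Proof.
rewrite nae_prob_meanD; congr (_ + _); rewrite -mulN1r -nae_prob_meanZ.
by apply: eq_nae_prob_mean => x y z; rewrite mulN1r.
Qed.

Lemma profile_probE (R : realType) (n : nat)
    (E : cube n -> cube n -> cube n -> bool) :
  profile_prob R E = nae_prob_mean (fun x y z => (E x y z)%:R).
Proof.
do 2!(apply: eq_bigr => ? _); rewrite big_mkcond /=.
by apply: eq_bigr => z _; case: ifP; rewrite ?mulr1 ?mulr0.
Qed.

Lemma unif_probE (R : realType) (n : nat) (E : pred (cube n)) :
  unif_prob R E = cube_mean (fun x => (E x)%:R).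
Proof.
rewrite /unif_prob /cube_mean /prod_mean.
under eq_bigr do rewrite prodr_const card_ord.
rewrite -mulr_sumr mulrC card_ffun card_bool card_ord natrX exprVn.
congr (_ * _); rewrite -sum1_card natr_sum big_mkcond /=.
by apply: eq_bigr => x _; rewrite inE; case: (E x).
Qed.

(** * Revealing the voters one at a time *)

Definition splice (n t : nat) (x x' : cube n) : cube n :=
  [ffun j : 'I_n => if (j < t)%N then x j else x' j].

Lemma splice_upd (n : nat) (t : 'I_n) (x x' : cube n) s :
  splice t x (upd x' t s) = splice t.+1 (upd x t s) x'.
Proof.
apply/ffunP => j; rewrite !ffunE ltnS [in RHS]leq_eqVlt -val_eqE /=.
by case: eqP => [->|//]; rewrite ltnn.
Qed.

Lemma splice_updr (n : nat) (t : 'I_n) (x x' : cube n) s :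
  splice t.+1 (upd x t s) x' = upd (splice t.+1 x x') t s.
Proof.
by apply/ffunP => j; rewrite !ffunE; case: (eqVneq j t) => [->|]; rewrite ?leqnn.
Qed.

(** Conditional expectation of [F] given the first [t] votes, kept as a function on the whole cube
    so that its type does not vary with [t]. *)
Definition tail_mean (R : realFieldType) (n t : nat) (F : cube n -> R)
    (x : cube n) : R :=
  cube_mean (fun x' => F (splice t x x')).

Lemma tail_mean0 (R : realFieldType) (n : nat) (F : cube n -> R) x :
  tail_mean 0 F x = cube_mean F.
Proof.
by apply: eq_cube_mean => x'; congr F; apply/ffunP => j; rewrite ffunE.
Qed.

Lemma tail_mean_full (R : realFieldType) (n : nat) (F : cube n -> R) x :
  tail_mean n F x = F x.
Proof.
rewrite -[RHS](cube_mean_cst n); apply: eq_cube_mean => x'; congr F.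
by apply/ffunP => j; rewrite ffunE ltn_ord.
Qed.

Lemma tail_mean_step (R : realFieldType) (n : nat) (t : 'I_n) (F : cube n -> R) x :
  tail_mean t F x =
  (tail_mean t.+1 F (upd x t true) + tail_mean t.+1 F (upd x t false)) / 2.
Proof.
rewrite /tail_mean (cube_mean_resample t) -cube_meanD mulrC -cube_meanZ.
by apply: eq_cube_mean => x'; rewrite !splice_upd mulrC.
Qed.

Lemma cube_mean_tail (R : realFieldType) (n t : nat) (F : cube n -> R) :
  (t <= n)%N -> cube_mean (tail_mean t F) = cube_mean F.
Proof.
elim: t => [_|t IH tn].
  by under eq_cube_mean do rewrite tail_mean0; rewrite cube_mean_cst.
rewrite -(IH (ltnW tn)) (cube_mean_resample (Ordinal tn)).
apply: eq_cube_mean => x.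
exact/esym/(tail_mean_step (Ordinal tn)).
Qed.

Lemma tail_mean_ge0 (R : realFieldType) (n t : nat) (F : cube n -> R) x :
  (forall x, 0 <= F x) -> 0 <= tail_mean t F x.
Proof. by move=> F0; apply: cube_mean_ge0. Qed.

Lemma tail_mean_le1 (R : realFieldType) (n t : nat) (F : cube n -> R) x :
  (forall x, F x <= 1) -> tail_mean t F x <= 1.
Proof.
by move=> F1; rewrite -[leRHS](cube_mean_cst n (1 : R)) le_cube_mean.
Qed.

Definition half_diff (R : realFieldType) (n : nat) (t : 'I_n) (F : cube n -> R)
    (x : cube n) : R :=
  (F (upd x t true) - F (upd x t false)) / 2.

Definition increment (R : realFieldType) (n : nat) (t : 'I_n) (F : cube n -> R) :=
  half_diff t (tail_mean t.+1 F).

Lemma tail_mean_jump (R : realFieldType) (n : nat) (t : 'I_n) (F : cube n -> R) x s :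
  tail_mean t.+1 F (upd x t s) = jump (tail_mean t F x) (increment t F x) s.
Proof.
by rewrite tail_mean_step /increment /half_diff /jump; case: s; field.
Qed.

Lemma increment_le (R : realFieldType) (n : nat) (t : 'I_n) (F : cube n -> R) x :
  (forall x, 0 <= F x) -> `|increment t F x| <= tail_mean t F x.
Proof.
move=> F0; have := tail_mean_ge0 t.+1 (upd x t true) F0.
have := tail_mean_ge0 t.+1 (upd x t false) F0.
rewrite !tail_mean_jump /= => h1 h2; rewrite ler_norml; lra.
Qed.

(** Differencing in coordinate [t] commutes with averaging over the later coordinates. *)
Lemma incrementE (R : realFieldType) (n : nat) (t : 'I_n) (F : cube n -> R) x :
  increment t F x = tail_mean t.+1 (half_diff t F) x.
Proof.
rewrite /increment /half_diff /tail_mean -cube_meanB mulrC -cube_meanZ.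
by apply: eq_cube_mean => x'; rewrite !splice_updr mulrC.
Qed.

(** Conditional expectation contracts the [L^1] norm. For an indicator the right-hand side is half
    the influence, which is how low influence enters. *)
Lemma increment_norm_mean (R : realFieldType) (n : nat) (t : 'I_n) (F : cube n -> R) :
  cube_mean (fun x => `|increment t F x|) <= cube_mean (fun x => `|half_diff t F x|).
Proof.
rewrite -[leRHS](cube_mean_tail _ (ltn_ord t)); apply: le_cube_mean => x.
rewrite incrementE ler_norml; apply/andP; split.
  rewrite -mulN1r -cube_meanZ; apply: le_cube_mean => x'.
  by rewrite mulN1r lerNl -normrN ler_norm.
by apply: le_cube_mean => x'; rewrite ler_norm.
Qed.

(* Orthogonality of martingale increments. *)
Lemma increment_sqr_sum (R : realFieldType) (n : nat) (F : cube n -> R) :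
  (forall x, 0 <= F x <= 1) ->
  \sum_(t < n) cube_mean (fun x => increment t F x ^+ 2) <= 1.
Proof.
move=> F01; pose V t := cube_mean (fun x => tail_mean t F x ^+ 2).
have -> : \sum_(t < n) cube_mean (fun x => increment t F x ^+ 2) =
    \sum_(t < n) (V t.+1 - V t).
  apply: eq_bigr => t _; rewrite /V [in RHS](cube_mean_resample t) -cube_meanB.
  apply: eq_cube_mean => x; by rewrite !tail_mean_jump /=; field.
rewrite -(big_mkord xpredT (fun t => V t.+1 - V t)) telescope_sumr //.
have V0 : 0 <= V 0%N by apply: cube_mean_ge0 => x; rewrite sqr_ge0.
suff : V n <= 1 by lra.
rewrite -(cube_mean_cst n (1 : R)); apply: le_cube_mean => x.
have h1 : tail_mean n F x <= 1 by apply: tail_mean_le1 => y; case/andP: (F01 y).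
have h0 : 0 <= tail_mean n F x by apply: tail_mean_ge0 => y; case/andP: (F01 y).
exact: exprn_ile1.
Qed.

(** Resampling voter [t] turns the one-step hypothesis into a bound between consecutive means, and
    these telescope. *)
Lemma submartingale_bound (R : realType) (n : nat)
    (Psi : nat -> cube n -> cube n -> cube n -> R)
    (loss : 'I_n -> cube n -> cube n -> cube n -> R) :
  (forall (t : 'I_n) x y z, Psi t x y z - loss t x y z <=
     nae_mean (fun a b c => Psi t.+1 (upd x t a) (upd y t b) (upd z t c))) ->
  nae_prob_mean (Psi 0%N) - \sum_(t < n) nae_prob_mean (loss t) <=
  nae_prob_mean (Psi n).
Proof.
move=> step; pose V t := nae_prob_mean (Psi t).
suff : \sum_(t < n) - nae_prob_mean (loss t) <= \sum_(t < n) (V t.+1 - V t).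
  rewrite -(big_mkord xpredT (fun t => V t.+1 - V t)) telescope_sumr // sumrN /V.
  lra.
apply: ler_sum => t _.
have : nae_prob_mean (fun x y z => Psi t x y z - loss t x y z) <= V t.+1.
  by rewrite /V [leRHS](nae_prob_mean_resample t); apply: le_nae_prob_mean => x y z.
rewrite nae_prob_meanB /V; lra.
Qed.

(** By [nae_mean_sqr] the product of the squared conditional means is a submartingale; it starts at
    the left-hand side and ends at the right-hand one. *)
Lemma reverse_pair (R : realType) (n : nat) (A B : cube n -> R) :
  cube_mean A ^+ 2 * cube_mean B ^+ 2 <=
  nae_prob_mean (fun x y _ => A x ^+ 2 * B y ^+ 2).
Proof.
pose Psi t (x y _ : cube n) := tail_mean t A x ^+ 2 * tail_mean t B y ^+ 2.
have := @submartingale_bound R n Psi (fun _ _ _ _ => 0).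
rewrite big1 ?subr0 => [|t _]; last exact: nae_prob_mean_cst.
have -> : nae_prob_mean (Psi 0%N) = cube_mean A ^+ 2 * cube_mean B ^+ 2.
  under eq_nae_prob_mean do rewrite /Psi !tail_mean0.
  exact: nae_prob_mean_cst.
have -> : nae_prob_mean (Psi n) =
    nae_prob_mean (fun x y _ => A x ^+ 2 * B y ^+ 2).
  by apply: eq_nae_prob_mean => x y z; rewrite /Psi !tail_mean_full.
apply => t x y z; rewrite subr0 /Psi.
by apply: le_trans (nae_mean_sqr _ _ _ _) _; rewrite /nae_mean !tail_mean_jump.
Qed.

Lemma exp3_root (R : realType) (a : R) : 0 <= a -> (a `^ 3^-1) ^+ 3 = a.
Proof. by move=> a0; rewrite -powR_mulrn ?powR_ge0 // -powRrM mulVf ?pnatr_eq0 // powRr1. Qed.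

(* Hypercontractivity at exponent 3/2: the product of the squared [L^3] norms of
   the unrevealed parts of [b] and [c] is a supermartingale. *)
Lemma hypercontractive_pair (R : realType) (n : nat) (b c : cube n -> R) (B C : R) :
  (forall x, 0 <= b x) -> (forall x, 0 <= c x) -> 0 <= B -> 0 <= C ->
  cube_mean (fun x => b x ^+ 3) = B ^+ 3 ->
  cube_mean (fun x => c x ^+ 3) = C ^+ 3 ->
  nae_prob_mean (fun _ y z => b y ^+ 2 * c z ^+ 2) <= B ^+ 2 * C ^+ 2.
Proof.
move=> b0 c0 B0 C0 bB cC.
pose rt (F : cube n -> R) t x := tail_mean t (fun x => F x ^+ 3) x `^ 3^-1.
have rt0 F t x : 0 <= rt F t x by exact: powR_ge0.
have rt3 (F : cube n -> R) (F0 : forall x, 0 <= F x) t x :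
    rt F t x ^+ 3 = tail_mean t (fun x => F x ^+ 3) x.
  by rewrite exp3_root // tail_mean_ge0 // => y; rewrite exprn_ge0.
have rt_full (F : cube n -> R) (F0 : forall x, 0 <= F x) x : rt F n x = F x.
  by rewrite /rt tail_mean_full -powR_mulrn // -powRrM mulfV ?pnatr_eq0 // powRr1.
have rt_cst F (L : R) (L0 : 0 <= L) x :
    cube_mean (fun x => F x ^+ 3) = L ^+ 3 -> rt F 0%N x = L.
  by move=> FL; rewrite /rt tail_mean0 FL -powR_mulrn // -powRrM mulfV ?pnatr_eq0 // powRr1.
have rt_step (F : cube n -> R) (F0 : forall x, 0 <= F x) (t : 'I_n) x : rt F t x ^+ 3 =
    (rt F t.+1 (upd x t true) ^+ 3 + rt F t.+1 (upd x t false) ^+ 3) / 2.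
  by rewrite !rt3 // tail_mean_step.
(* The sign turns the supermartingale into a submartingale, as [submartingale_bound] requires. *)
pose Psi t (_ y z : cube n) := - (rt b t y ^+ 2 * rt c t z ^+ 2).
have := @submartingale_bound R n Psi (fun _ _ _ _ => 0).
rewrite big1 ?subr0 => [|t _]; last exact: nae_prob_mean_cst.
have -> : nae_prob_mean (Psi 0%N) = - (B ^+ 2 * C ^+ 2).
  rewrite -(nae_prob_mean_cst n (- (B ^+ 2 * C ^+ 2))); apply: eq_nae_prob_mean => x y z.
  by rewrite /Psi (rt_cst _ _ B0) // (rt_cst _ _ C0).
have -> : nae_prob_mean (Psi n) =
    - nae_prob_mean (fun _ y z => b y ^+ 2 * c z ^+ 2).
  rewrite -mulN1r -nae_prob_meanZ; apply: eq_nae_prob_mean => x y z.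
  by rewrite /Psi !rt_full // mulN1r.
rewrite lerN2; apply => t x y z; rewrite subr0 /Psi.
have := nae_mean_cube_le (fun s => rt0 b t.+1 (upd y t s))
  (fun s => rt0 c t.+1 (upd z t s)) (rt0 b t y) (rt0 c t z)
  (rt_step b b0 t y) (rt_step c c0 t z).
rewrite /nae_mean; lra.
Qed.

(** * Low influences and distinct pivots *)

(* The loss at step [t] is at most 625 times the mean of the squared increments of
   [B] and [C], which hypercontractivity and low influence make summably small. *)
Lemma reverse_triple (R : realType) (n : nat) (A B C : cube n -> R) (th : R) :
  (forall x, 0 <= A x <= 1) -> (forall x, 0 <= B x <= 1) ->
  (forall x, 0 <= C x <= 1) -> 0 <= th ->
  (forall t, cube_mean (fun x => `|half_diff t B x|) <= th ^+ 3) ->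
  (forall t, cube_mean (fun x => `|half_diff t C x|) <= th ^+ 3) ->
  (cube_mean A * cube_mean B * cube_mean C) ^+ 4 - 625 * th <=
  nae_prob_mean (fun x y z => (A x * B y * C z) ^+ 4).
Proof.
move=> A01 B01 C01 th0 Bth Cth.
have nonneg (F : cube n -> R) : (forall x, 0 <= F x <= 1) -> forall x, 0 <= F x.
  by move=> F01 x; case/andP: (F01 x).
have jumps (F : cube n -> R) : (forall x, 0 <= F x <= 1) -> forall t x,
    `|increment t F x| <= tail_mean t F x <= 1.
  move=> F01 t x; rewrite increment_le; last exact: nonneg.
  by apply: tail_mean_le1 => y; case/andP: (F01 y).
pose cb (F : cube n -> R) t := cube_mean (fun x => `|increment t F x| ^+ 3).
pose rt (F : cube n -> R) t := cb F t `^ 3^-1.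
have cb0 F t : 0 <= cb F t by apply: cube_mean_ge0 => x; rewrite exprn_ge0.
have rt0 F t : 0 <= rt F t by exact: powR_ge0.
have rtE F t : rt F t ^+ 3 = cb F t by exact: exp3_root.
(* Increments are at most 1 in absolute value, so their third moment is bounded both by the first
   moment, giving [rt F t <= th], and by the second. One factor [rt F t] is bounded the first way
   and the remaining cube the second way. *)
have rt4 (F : cube n -> R) t : (forall x, 0 <= F x <= 1) ->
    cube_mean (fun x => `|half_diff t F x|) <= th ^+ 3 ->
    rt F t ^+ 4 <= th * cube_mean (fun x => increment t F x ^+ 2).
  move=> F01 Fth; have inc1 x : `|increment t F x| <= 1.
    by case/andP: (jumps F F01 t x) => h1 h2; exact: le_trans h2.
  have rt_th : rt F t <= th.
    rewrite -(@ler_pXn2r _ 3) ?nnegrE // rtE; apply: le_trans Fth.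
    apply: le_trans (increment_norm_mean _ _); apply: le_cube_mean => x.
    by rewrite exprS; apply: ler_piMr => //; exact: exprn_ile1.
  rewrite exprS rtE; apply: ler_pM => //; apply: le_cube_mean => x.
  rewrite exprSr -normrX ger0_norm ?sqr_ge0 //; apply: ler_piMr => //.
  exact: sqr_ge0.
pose Psi t (x y z : cube n) :=
  (tail_mean t A x * tail_mean t B y * tail_mean t C z) ^+ 4.
pose loss t (_ y z : cube n) :=
  625 * (increment t B y ^+ 2 * increment t C z ^+ 2).
have := @submartingale_bound R n Psi loss.
have -> : nae_prob_mean (Psi 0%N) =
    (cube_mean A * cube_mean B * cube_mean C) ^+ 4.
  under eq_nae_prob_mean do rewrite /Psi !tail_mean0.
  exact: nae_prob_mean_cst.
have -> : nae_prob_mean (Psi n) =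
    nae_prob_mean (fun x y z => (A x * B y * C z) ^+ 4).
  by apply: eq_nae_prob_mean => x y z; rewrite /Psi !tail_mean_full.
move=> bound; apply: le_trans (bound _); last first.
  move=> t x y z.
  apply: le_trans (nae_mean_pow4_loss (jumps A A01 t x) (jumps B B01 t y)
    (jumps C C01 t z)) _.
  by rewrite /nae_mean /Psi !tail_mean_jump.
rewrite lerD2l lerN2.
pose V (F : cube n -> R) t := cube_mean (fun x => increment t F x ^+ 2).
(* AM-GM splits the product of the squared [L^3] norms into fourth powers, to which [rt4] applies;
   each [V] then sums to at most 1. *)
apply: (@le_trans _ _ (\sum_(t < n) 625 * (th / 2 * V B t + th / 2 * V C t))).
  apply: ler_sum => t _; rewrite nae_prob_meanZ ler_wpM2l //.
  have H : nae_prob_mean (fun _ y z =>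
      increment t B y ^+ 2 * increment t C z ^+ 2) <= rt B t ^+ 2 * rt C t ^+ 2.
    apply: le_trans (hypercontractive_pair (fun x => normr_ge0 (increment t B x))
      (fun x => normr_ge0 (increment t C x)) (rt0 B t) (rt0 C t) _ _);
      rewrite ?rtE //.
    by apply: le_nae_prob_mean => x y z; rewrite !real_normK ?num_real.
  have hB := rt4 B t B01 (Bth t); have hC := rt4 C t C01 (Cth t).
  have := sqr_ge0 (rt B t ^+ 2 - rt C t ^+ 2).
  rewrite /V; lra.
rewrite -mulr_sumr ler_wpM2l // big_split -!mulr_sumr /=.
have hB := increment_sqr_sum B01; have hC := increment_sqr_sum C01.
have th2 : 0 <= th / 2 by rewrite divr_ge0.
have := ler_wpM2l th2 hB; have := ler_wpM2l th2 hC; rewrite /V; lra.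
Qed.

Definition all_equal (n : nat) (f g h : cube n -> bool) (x y z : cube n) : bool :=
  (f x == g y) && (g y == h z).

Definition pivotal (n : nat) (i : 'I_n) (f : cube n -> bool) (x : cube n) : bool :=
  f (upd x i true) != f (upd x i false).

Definition influence (R : realFieldType) (n : nat) (i : 'I_n)
    (f : cube n -> bool) : R :=
  cube_mean (fun x => (pivotal i f x)%:R).

(** Only the votes with opposite x- and z-bits are kept, which leaves the y-bit free;
    [nae_mean_ge_middle] frees the x-bit likewise. *)
Lemma nae_mean_ge_outer (R : realFieldType) (F : bool -> bool -> bool -> R) :
  (forall s t r, 0 <= F s t r) ->
  (F true true false + F true false false + F false true true
   + F false false true) / 6 <= nae_mean F.
Proof.
move=> F0; rewrite /nae_mean.
have := F0 true false true; have := F0 false true false; lra.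
Qed.

Lemma nae_mean_ge_middle (R : realFieldType) (F : bool -> bool -> bool -> R) :
  (forall s t r, 0 <= F s t r) ->
  (F true true false + F false true false + F true false true
   + F false false true) / 6 <= nae_mean F.
Proof.
move=> F0; rewrite /nae_mean.
have := F0 true false false; have := F0 false true true; lra.
Qed.

(* Unprimed bits are votes of [i], primed bits votes of [j].  Fix the x-bit [s'] and
   the y-bit [t]; giving [z] the opposite bits there frees the x-bit of [i] and the
   y-bit of [j], so pivotal [f] and [g] can be steered to the value of [h]. *)
Lemma two_pivots_local (R : realFieldType) (F G H : bool -> bool -> bool) :
  nae_mean (fun s' _ _ => nae_mean (fun _ t _ =>
    (F true s' != F false s')%:R ^+ 2 * (G t true != G t false)%:R ^+ 2)) / 9 <=
  nae_mean (fun s' t' r' => nae_mean (fun s t r =>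
    ((F s s' == G t t') && (G t t' == H r r'))%:R)) :> R.
Proof.
pose E s' t' r' s t r : R := ((F s s' == G t t') && (G t t' == H r r'))%:R.
have E0 s' t' r' s t r : 0 <= E s' t' r' s t r by exact: ler0n.
pose I s' t' r' := nae_mean (E s' t' r').
have I0 s' t' r' : 0 <= I s' t' r' by exact/nae_mean_ge0/E0.
have inner s' t' r' : (E s' t' r' true true false + E s' t' r' false true false +
    E s' t' r' true false true + E s' t' r' false false true) / 6 <= I s' t' r'.
  exact/nae_mean_ge_middle/E0.
pose a s' t : R := (F true s' != F false s')%:R ^+ 2 * (G t true != G t false)%:R ^+ 2.
(* The four terms run over the free bits [s] and [t']; when both functions are pivotal, one choice
   gives [f] and [g] the value of [h]. *)
have pick s' t : a s' t
    <= E s' true (~~ s') true t (~~ t) + E s' true (~~ s') false t (~~ t)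
     + E s' false (~~ s') true t (~~ t) + E s' false (~~ s') false t (~~ t).
  rewrite /E /a; case: (F true s') (F false s') (G t true) (G t false)
    (H (~~ t) (~~ s')) => [] [] [] [] [] /=; lra.
(* Each legal pair of votes has weight 1/36, while the pair [(s', t)] is uniform on four values:
   hence the factor 4/36 = 1/9. *)
rewrite -[leRHS]/(nae_mean I); apply: le_trans (nae_mean_ge_outer I0).
have -> : nae_mean (fun s' _ _ => nae_mean (fun _ t _ => a s' t)) =
    (a true true + a true false + a false true + a false false) / 4.
  by rewrite /nae_mean; field.
have := inner true true false; have := inner true false false.
have := inner false true true; have := inner false false true.
have := pick true true; have := pick true false.
have := pick false true; have := pick false false.
rewrite /=; lra.
Qed.

(** [reverse_pair] makes both pivots occur together with noticeable probability; resampling voters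
    [i] and [j] then reduces the claim to [two_pivots_local]. *)
Lemma two_pivots (R : realType) (n : nat) (i j : 'I_n) (f g h : cube n -> bool) :
  i != j ->
  influence R i f ^+ 2 * influence R j g ^+ 2 / 9 <=
  nae_prob_mean (fun x y z => (all_equal f g h x y z)%:R).
Proof.
move=> ij.
have := reverse_pair (fun x => (pivotal i f x)%:R : R) (fun x => (pivotal j g x)%:R).
rewrite -/(influence R i f) -/(influence R j g) => h1.
apply: le_trans (ler_wpM2r _ h1) _; first by rewrite invr_ge0.
rewrite mulrC -nae_prob_meanZ (nae_prob_mean_resample i) [leLHS](nae_prob_mean_resample j).
rewrite [leRHS](nae_prob_mean_resample i) [leRHS](nae_prob_mean_resample j).
apply: le_nae_prob_mean => x y z.
pose F s s' := f (upd (upd x j s') i s).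
pose G t t' := g (upd (upd y j t') i t).
pose H r r' := h (upd (upd z j r') i r).
have := two_pivots_local R F G H.
rewrite /nae_mean /pivotal /all_equal /F /G /H !upd_upd.
have jy t t' t'' : upd (upd (upd y j t) i t') j t'' = upd (upd y j t'') i t'.
  by rewrite (updC _ _ _ ij) upd_upd.
rewrite !jy; lra.
Qed.

(** * Restricting one voter *)

Definition all_equal_prob (R : realType) (n : nat) (f g h : cube n -> bool) : R :=
  nae_prob_mean (fun x y z => (all_equal f g h x y z)%:R).

Lemma nae_prob_mean_swap12 (R : realType) (n : nat)
    (F : cube n -> cube n -> cube n -> R) :
  nae_prob_mean F = nae_prob_mean (fun x y z => F y x z).
Proof.
rewrite /nae_prob_mean exchange_big; do 3!(apply: eq_bigr => ? _).
congr (_ * _); apply: eq_bigr => i _; rewrite /voter_pmf.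
by congr (_%:R / _); rewrite !inE; do 3!case: (_ i).
Qed.

Lemma nae_prob_mean_swap23 (R : realType) (n : nat)
    (F : cube n -> cube n -> cube n -> R) :
  nae_prob_mean F = nae_prob_mean (fun x y z => F x z y).
Proof.
apply: eq_bigr => x _; rewrite exchange_big; do 2!(apply: eq_bigr => ? _).
congr (_ * _); apply: eq_bigr => i _; rewrite /voter_pmf.
by congr (_%:R / _); rewrite !inE; do 3!case: (_ i).
Qed.

Lemma all_equal_prob_swap12 (R : realType) (n : nat) (f g h : cube n -> bool) :
  all_equal_prob R f g h = all_equal_prob R g f h.
Proof.
rewrite /all_equal_prob nae_prob_mean_swap12.
apply: eq_nae_prob_mean => x y z; congr (_%:R); rewrite /all_equal.
by case: (f y) (g x) (h z) => [] [] [].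
Qed.

Lemma all_equal_prob_swap23 (R : realType) (n : nat) (f g h : cube n -> bool) :
  all_equal_prob R f g h = all_equal_prob R f h g.
Proof.
rewrite /all_equal_prob nae_prob_mean_swap23.
apply: eq_nae_prob_mean => x y z; congr (_%:R); rewrite /all_equal.
by case: (f x) (g z) (h y) => [] [] [].
Qed.

Definition restrict (n : nat) (i : 'I_n) (s : bool) (f : cube n -> bool) :
    cube n -> bool := fun x => f (upd x i s).

Definition low_off (R : realFieldType) (n : nat) (i : 'I_n) (eta : R)
    (f : cube n -> bool) : Prop :=
  forall j, j != i -> influence R j f <= eta.

Lemma influence_ge0 (R : realFieldType) (n : nat) (i : 'I_n) (f : cube n -> bool) :
  0 <= influence R i f.
Proof. exact: cube_mean_ge0. Qed.

(** For [j != i] the influence is the average over the two restrictions, so either one at most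
    doubles it; voter [i] itself loses all influence. *)
Lemma influence_restrict (R : realFieldType) (n : nat) (i j : 'I_n) (s : bool)
    (f : cube n -> bool) (eta : R) : 0 <= eta -> low_off i eta f ->
  influence R j (restrict i s f) <= 2 * eta.
Proof.
move=> eta0 low; have [->|ji] := eqVneq j i.
  apply: (@le_trans _ _ 0); last by rewrite mulr_ge0.
  rewrite -(cube_mean_cst n (0 : R)); apply: le_cube_mean => x.
  by rewrite /pivotal /restrict !upd_upd eqxx.
apply: (@le_trans _ _ (2 * influence R j f)); last by rewrite ler_wpM2l ?low.
rewrite /influence (cube_mean_resample i (fun x => (pivotal j f x)%:R)) -cube_meanZ.
apply: le_cube_mean => x.
have e b : pivotal j f (upd x i b) = pivotal j (restrict i b f) x.
  by rewrite /pivotal /restrict !(updC _ _ _ ji).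
rewrite !e; have h b : 0 <= (pivotal j (restrict i b f) x)%:R :> R by [].
by have := h true; have := h false; case: s; lra.
Qed.

(** Each of the six legal votes of [i] is cast with probability 1/6. *)
Lemma all_equal_prob_restrict (R : realType) (n : nat) (i : 'I_n)
    (f g h : cube n -> bool) (s t r : bool) : (s, t, r) \in nae ->
  all_equal_prob R (restrict i s f) (restrict i t g) (restrict i r h) <=
  6 * all_equal_prob R f g h.
Proof.
move=> str; rewrite /all_equal_prob [in leRHS](nae_prob_mean_resample i).
rewrite -nae_prob_meanZ; apply: le_nae_prob_mean => x y z.
rewrite /nae_mean.
pose E a b c : R := (all_equal f g h (upd x i a) (upd y i b) (upd z i c))%:R.
have E0 a b c : 0 <= E a b c by exact: ler0n.
rewrite -[leLHS]/(E s t r) -!/(E _ _ _).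
have := E0 true true false; have := E0 true false true.
have := E0 true false false; have := E0 false true true.
have := E0 false true false; have := E0 false false true.
by move: str; rewrite !inE; case: s t r => [] [] []//= _; lra.
Qed.

(** A boolean form of closeness to a constant, to allow the case enumeration of [single_voter]. *)
Definition near_cst (R : realType) (n : nat) (e : R) (f : cube n -> bool)
    (c : bool) : bool := unif_prob R (fun x => f x != c) <= e.

(** [reverse_triple] for the three events of taking the value [c], each of probability above [e]:
    three factors to the fourth power give [e^12]. *)
Lemma all_equal_prob_ge (R : realType) (n : nat) (e th : R)
    (f g h : cube n -> bool) (c : bool) : 0 < e -> 0 <= th ->
  (forall t, influence R t g <= 2 * th ^+ 3) ->
  (forall t, influence R t h <= 2 * th ^+ 3) ->
  ~~ near_cst e f (~~ c) -> ~~ near_cst e g (~~ c) -> ~~ near_cst e h (~~ c) ->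
  e ^+ 12 - 625 * th <= all_equal_prob R f g h.
Proof.
move=> e0 th0 gth hth.
rewrite /near_cst -!ltNge !unif_probE => fe ge he.
(* This is the indicator of [u x = c], in the form that occurs in [near_cst]. *)
pose I (u : cube n -> bool) x : R := (u x != ~~ c)%:R.
have I01 u x : 0 <= I u x <= 1 by rewrite /I ler0n lern1 leq_b1.
have half u t : influence R t u <= 2 * th ^+ 3 ->
    cube_mean (fun x => `|half_diff t (I u) x|) <= th ^+ 3.
  move=> uth; apply: (@le_trans _ _ (1 / 2 * influence R t u)); last lra.
  rewrite -cube_meanZ; apply: le_cube_mean => x; rewrite /half_diff /I /pivotal.
  rewrite ler_norml; by move: (u _) (u _) (~~ c) => [] [] [] /=; lra.
have := reverse_triple (I01 f) (I01 g) (I01 h) th0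
  (fun t => half g t (gth t)) (fun t => half h t (hth t)).
have : e ^+ 12 <= (cube_mean (I f) * cube_mean (I g) * cube_mean (I h)) ^+ 4.
  have -> : e ^+ 12 = (e * e * e) ^+ 4 by ring.
  have e0' := ltW e0.
  have le_e : e * e * e <= cube_mean (I f) * cube_mean (I g) * cube_mean (I h).
    apply: ler_pM; [exact: mulr_ge0|by []| |exact: ltW].
    by apply: ler_pM; rewrite ?e0' // ltW.
  have e30 : 0 <= e * e * e by rewrite !mulr_ge0.
  by rewrite ler_pXn2r ?nnegrE // (le_trans e30).
have : nae_prob_mean (fun x y z => (I f x * I g y * I h z) ^+ 4) <=
    all_equal_prob R f g h.
  apply: le_nae_prob_mean => x y z; rewrite /I /all_equal.
  move: (f x) (g y) (h z) (~~ c) => [] [] [] [] /=;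
    rewrite ?mulr1 ?mulr0 ?mul0r ?expr1n ?expr0n //=.
lra.
Qed.

Definition opposite_cst (p q : bool -> bool) : bool :=
  p true && q false || p false && q true.

(** The distances to the two constants add up to 1. *)
Lemma near_cst_excl (R : realType) (n : nat) (e : R) (u : cube n -> bool) :
  e < 1 / 2 -> ~~ (near_cst e u true && near_cst e u false).
Proof.
move=> e2; apply/negP; rewrite /near_cst !unif_probE => /andP[h1 h0].
have : cube_mean (fun x => (u x != true)%:R + (u x != false)%:R) = 1 :> R.
  rewrite -[RHS](cube_mean_cst n); apply: eq_cube_mean => x.
  by case: (u x); rewrite ?addr0 ?add0r.
rewrite cube_meanD; lra.
Qed.

(** By [all_equal_prob_ge], each of the two constants must be approximated by some function;
    [near_cst_excl] makes these two functions distinct. *)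
Lemma all_equal_prob_dichotomy (R : realType) (n : nat) (e th : R)
    (f g h : cube n -> bool) : 0 < e < 1 / 2 -> 0 <= th ->
  let low u := forall t, influence R t u <= 2 * th ^+ 3 in
  (low g /\ low h) \/ (low f /\ low h) \/ (low f /\ low g) ->
  all_equal_prob R f g h < e ^+ 12 - 625 * th ->
  [|| opposite_cst (near_cst e f) (near_cst e g),
      opposite_cst (near_cst e f) (near_cst e h) |
      opposite_cst (near_cst e g) (near_cst e h)].
Proof.
move=> /andP[e0 e2] th0 low lows small.
have excl (u : cube n -> bool) := near_cst_excl u e2.
have main c : ~~ [&& ~~ near_cst e f (~~ c), ~~ near_cst e g (~~ c) &
    ~~ near_cst e h (~~ c)].
  apply/negP => /and3P[fc gc hc]; move: small; apply/negP; rewrite -leNgt.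
  case: lows => [[lg lh]|[[lf lh]|[lf lg]]].
  - exact: (all_equal_prob_ge (c := c)).
  - by rewrite all_equal_prob_swap12; exact: (all_equal_prob_ge (c := c)).
  - rewrite all_equal_prob_swap23 all_equal_prob_swap12.
    exact: (all_equal_prob_ge (c := c)).
have := main true; have := main false; have := excl f; have := excl g;
have := excl h.
rewrite /opposite_cst /=.
by do 6!case: (near_cst e _ _).
Qed.

(* The three-valued version of the theorem for a single voter: [p s], [q s],
   [r s] record which constants the restrictions to [x_i = s] are close to. *)
Lemma single_voter (p q r : bool -> bool -> bool) :
  (forall s, ~~ (p s true && p s false)) ->
  (forall s, ~~ (q s true && q s false)) ->
  (forall s, ~~ (r s true && r s false)) ->
  (forall a b c, (a, b, c) \in nae ->
    [|| opposite_cst (p a) (q b), opposite_cst (p a) (r c) |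
        opposite_cst (q b) (r c)]) ->
  (exists c, (forall s, p s c) /\ (forall s, q s (~~ c))) \/
  (exists c, (forall s, p s c) /\ (forall s, r s (~~ c))) \/
  (exists c, (forall s, q s c) /\ (forall s, r s (~~ c))) \/
  (exists k, forall s, [/\ p s (s == k), q s (s == k) & r s (s == k)]).
Proof.
move=> P Q S H.
(* The conclusion is made boolean for enumeration: exclusivity leaves three states for each function
   and each vote. *)
have : [|| has (fun c => [&& p true c, p false c, q true (~~ c) & q false (~~ c)]) [:: true; false],
   has (fun c => [&& p true c, p false c, r true (~~ c) & r false (~~ c)]) [:: true; false],
   has (fun c => [&& q true c, q false c, r true (~~ c) & r false (~~ c)]) [:: true; false] |
   has (fun k => [&& p true (true == k), p false (false == k),
     q true (true == k), q false (false == k), r true (true == k) & r false (false == k)])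
     [:: true; false]].
  have := H true true false; have := H true false true; have := H true false false.
  have := H false true true; have := H false true false; have := H false false true.
  rewrite !inE /= => /(_ isT) + /(_ isT) + /(_ isT) + /(_ isT) + /(_ isT) + /(_ isT).
  have := P true; have := P false; have := Q true; have := Q false.
  have := S true; have := S false; clear.
  rewrite /opposite_cst.
  case: (p true true) (p true false) => [] []//=;
  case: (p false true) (p false false) => [] []//=;
  case: (q true true) (q true false) => [] []//=;
  case: (q false true) (q false false) => [] []//=;
  case: (r true true) (r true false) => [] []//=;
  by case: (r false true) (r false false) => [] [].
case/or4P => /hasP[c _].
- by case/and4P=> *; left; exists c; split; case.
- by case/and4P=> *; right; left; exists c; split; case.
- by case/and4P=> *; right; right; left; exists c; split; case.
- case/and5P=> ? ? ? ? /andP[? ?]; do 3!right; exists c; case; by split.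
Qed.

(** * The dichotomy *)

(** The distance is the average of the distances of the two restrictions. A constant [d] yields a
    constant function, and [d s = (s == k)] a dictator. *)
Lemma close_of_restrict (R : realType) (n : nat) (i : 'I_n) (e : R)
    (f : cube n -> bool) (d : bool -> bool) :
  (forall s, near_cst e (restrict i s f) (d s)) -> close e f (fun x => d (x i)).
Proof.
move=> near; rewrite /close unif_probE (cube_mean_resample i).
have := near true; have := near false; rewrite /near_cst !unif_probE => h0 h1.
rewrite (@eq_cube_mean _ _ _ (fun x => 1 / 2 *
  ((restrict i true f x != d true)%:R + (restrict i false f x != d false)%:R))).
  by rewrite cube_meanZ cube_meanD; lra.
by move=> x; rewrite !upd_eq /restrict mulrC mul1r.
Qed.

(** If [g] or [h] has an influential voter [i], the other two functions have none besides [i].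
    Otherwise [g] and [h] have none at all, and any voter serves. *)
Lemma low_pair (R : realFieldType) (n : nat) (eta : R) (f g h : cube n -> bool) :
  (0 < n)%N ->
  (forall i j, i != j -> (influence R i f <= eta) || (influence R j g <= eta)) ->
  (forall i j, i != j -> (influence R i f <= eta) || (influence R j h <= eta)) ->
  (forall i j, i != j -> (influence R i g <= eta) || (influence R j h <= eta)) ->
  exists i : 'I_n, (low_off i eta g /\ low_off i eta h) \/
    (low_off i eta f /\ low_off i eta h) \/ (low_off i eta f /\ low_off i eta g).
Proof.
move=> n0 fg fh gh.
have [/existsP[i gi]|/existsPn gl] := boolP [exists i, eta < influence R i g].
  exists i; right; left; split=> j ji.
    by have := fg j i ji; rewrite [in X in _ || X]leNgt gi orbF.
  by have := gh i j; rewrite eq_sym leNgt gi => /(_ ji).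
have [/existsP[i hi]|/existsPn hl] := boolP [exists i, eta < influence R i h].
  exists i; right; right; split=> j ji.
    by have := fh j i ji; rewrite [in X in _ || X]leNgt hi orbF.
  by rewrite leNgt gl.
by exists (Ordinal n0); left; split=> j _; rewrite leNgt ?gl ?hl.
Qed.

(** The choice of [th] makes the loss [625 * th] half of [e^12]; the influence threshold is [th^3],
    and its fourth power over 9 is the bound of [two_pivots]. *)
Lemma arrow_polynomial (R : realType) (n : nat) (e th : R) (f g h : cube n -> bool) :
  (0 < n)%N -> 0 < e < 1 / 2 -> th = e ^+ 12 / 1250 ->
  all_equal_prob R f g h < th ^+ 12 / 9 ->
  (close_to_opposite_constants e f g \/ close_to_opposite_constants e f h \/
   close_to_opposite_constants e g h) \/
  (exists (i : 'I_n) (d : cube n -> bool),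
     is_dictator i d /\ close e f d /\ close e g d /\ close e h d).
Proof.
move=> n0 e02 thE small; have /andP[e0 e2] := e02.
have e12 : e ^+ 12 <= 1 by apply: exprn_ile1; lra.
have e12p : 0 < e ^+ 12 by rewrite exprn_gt0.
have th0 : 0 < th by rewrite thE divr_gt0.
have th1 : th <= 1 by lra.
pose eta := th ^+ 3; have eta0 : 0 < eta by rewrite exprn_gt0.
have small_pair (u v : cube n -> bool) :
    (forall i j, i != j -> influence R i u ^+ 2 * influence R j v ^+ 2 / 9 <=
      all_equal_prob R f g h) ->
    forall i j, i != j -> (influence R i u <= eta) || (influence R j v <= eta).
  move=> uv i j ij; rewrite !leNgt -negb_and; apply/negP => /andP[ui vj].
  have h1 : eta ^+ 2 <= influence R i u ^+ 2.
    by rewrite ler_pXn2r ?nnegrE ?influence_ge0 // ltW.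
  have h2 : eta ^+ 2 <= influence R j v ^+ 2.
    by rewrite ler_pXn2r ?nnegrE ?influence_ge0 // ltW.
  have h3 : eta ^+ 2 * eta ^+ 2 <= influence R i u ^+ 2 * influence R j v ^+ 2.
    by apply: ler_pM => //; exact: sqr_ge0.
  have h4 : th ^+ 12 = eta ^+ 2 * eta ^+ 2 by rewrite /eta; ring.
  have := uv i j ij; lra.
have fg : forall i j, i != j -> (influence R i f <= eta) || (influence R j g <= eta).
  by apply: small_pair => i j; exact: two_pivots.
have fh : forall i j, i != j -> (influence R i f <= eta) || (influence R j h <= eta).
  by apply: small_pair => i j; rewrite all_equal_prob_swap23; exact: two_pivots.
have gh : forall i j, i != j -> (influence R i g <= eta) || (influence R j h <= eta).
  apply: small_pair => i j.
  by rewrite all_equal_prob_swap12 all_equal_prob_swap23; exact: two_pivots.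
have [i lows] := low_pair n0 fg fh gh.
have lowr u s : low_off i eta u ->
    forall t, influence R t (restrict i s u) <= 2 * th ^+ 3.
  by move=> lu t; apply: influence_restrict => //; exact: ltW.
have th12 : th ^+ 12 <= th.
  rewrite exprS; apply: ler_piMr; first exact: ltW.
  by apply: exprn_ile1 => //; exact: ltW.
have excl (u : cube n -> bool) : ~~ (near_cst e u true && near_cst e u false).
  exact: near_cst_excl.
have dich a b c : (a, b, c) \in nae ->
    [|| opposite_cst (near_cst e (restrict i a f)) (near_cst e (restrict i b g)),
        opposite_cst (near_cst e (restrict i a f)) (near_cst e (restrict i c h)) |
        opposite_cst (near_cst e (restrict i b g)) (near_cst e (restrict i c h))].
  move=> abc; apply: (all_equal_prob_dichotomy e02 (ltW th0)).
    by case: lows => [[? ?]|[[? ?]|[? ?]]]; [left|right; left|right; right];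
      split; exact: lowr.
  (* Six times the probability is below [th], whereas [e^12 - 625 * th] equals [625 * th]. *)
  by apply: le_lt_trans (all_equal_prob_restrict R i f g h abc) _; lra.
have cst (u : cube n -> bool) c : (forall s, near_cst e (restrict i s u) c) ->
    close e u (fun=> c) by exact: (close_of_restrict (d := fun=> c)).
have [[c [A B]]|[[c [A B]]|[[c [A B]]|[k K]]]] :=
  single_voter (fun s => excl (restrict i s f)) (fun s => excl (restrict i s g))
    (fun s => excl (restrict i s h)) dich.
- by left; left; exists c; split; exact: cst.
- by left; right; left; exists c; split; exact: cst.
- by left; right; right; exists c; split; exact: cst.
right; exists i, (fun x : cube n => x i == k); split.
  case: k {K}; [left|right]; apply: boolp.funext => x; first by rewrite eqb_id.
  by rewrite eqbF_neg.
by do 2?split; apply: (close_of_restrict (d := fun s => s == k)) => s;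
  case: (K s).
Qed.

Lemma close_le (R : realType) (n : nat) (e e' : R) (u v : cube n -> bool) :
  e <= e' -> close e u v -> close e' u v.
Proof. by move=> ee h; exact: le_trans ee. Qed.

(** Seventh power of [exp (y / 7) >= y / 7]. With [y] of order [eps^-21] this gives order [eps^147],
    enough to beat the [e^144] of [arrow_polynomial]. *)
Lemma expRN_le_pow7 (R : realType) (y : R) : 0 < y -> expR (- y) <= (7 / y) ^+ 7.
Proof.
move=> y0; have -> : - y = 7%:R * - (y / 7) by field.
have y7 : 0 < 7 / y by rewrite divr_gt0.
rewrite expRM_natl ler_pXn2r ?nnegrE ?expR_ge0 ?(ltW y7) //.
have -> : 7 / y = (y / 7)^-1 by rewrite invf_div.
rewrite expRN lef_pV2 ?posrE ?expR_gt0 ?divr_gt0 //.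
by have := expR_ge1Dx (y / 7); lra.
Qed.

Theorem theorem3p13 (R : realType) :
  exists C : R, 0 < C /\
    forall (eps : R), 0 < eps ->
    forall (n : nat), (1 <= n)%N ->
    forall (f g h : cube n -> bool),
      profile_prob R (fun x y z => (f x == g y) && (g y == h z))
        < expR (- (C / eps ^+ 21)) ->
      (close_to_opposite_constants eps f g \/
       close_to_opposite_constants eps f h \/
       close_to_opposite_constants eps g h) \/
      (exists (i : 'I_n) (d : cube n -> bool),
         is_dictator i d /\
         close eps f d /\ close eps g d /\ close eps h d).
Proof.
(* [K] compensates for [e = eps / 3], [m] is the denominator of [th], and [63 = 7 * 9] cancels the 7
   of [expRN_le_pow7] while leaving a 9. *)
pose K : R := 3 ^+ 21; pose m : R := 1250.
have K0 : 0 < K by rewrite exprn_gt0.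
have m1 : 1 <= m by rewrite /m ler1n.
have C0 : 0 < 63 * K * m ^+ 2 by rewrite !mulr_gt0 // exprn_gt0; lra.
exists (63 * K * m ^+ 2); split=> // eps eps0 n n0 f g h.
rewrite profile_probE => small.
(* For [eps >= 1] any two functions are close. *)
have [eps1|eps1] := leP 1 eps.
  left; left; exists true.
  have any (u v : cube n -> bool) : close eps u v.
    rewrite /close unif_probE; apply: le_trans eps1.
    rewrite -[leRHS](cube_mean_cst n (1 : R)); apply: le_cube_mean => x.
    by rewrite lern1 leq_b1.
  by split; exact: any.
(* Division by 3 puts [e] below 1/2, where closeness to both constants is impossible. *)
pose e := eps / 3; have e0 : 0 < e by rewrite divr_gt0.
have e_eps : e <= eps by rewrite /e; lra.
have e02 : 0 < e < 1 / 2 by rewrite e0 /e; lra.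
have bound : expR (- (63 * K * m ^+ 2 / eps ^+ 21)) <= (e ^+ 12 / m) ^+ 12 / 9.
  apply: le_trans (expRN_le_pow7 _) _; first by rewrite divr_gt0 ?exprn_gt0.
  have -> : 7 / (63 * K * m ^+ 2 / eps ^+ 21) = e ^+ 21 / (9 * m ^+ 2).
    rewrite /e expr_div_n -/K; field.
    by rewrite !gt_eqF ?exprn_gt0 //; lra.
  (* The spare factor, with [e^3] from [147 = 144 + 3] and [m^2] from [14 = 12 + 2], is at most
     1. *)
  have -> : (e ^+ 21 / (9 * m ^+ 2)) ^+ 7 =
      (e ^+ 12 / m) ^+ 12 / 9 * (e ^+ 3 / (9 ^+ 6 * m ^+ 2)).
    by field.
  apply: ler_piMr; first by rewrite divr_ge0 // exprn_ge0 // divr_ge0 ?exprn_ge0; lra.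
  rewrite ler_pdivrMr; last by rewrite mulr_gt0 // exprn_gt0; lra.
  rewrite mul1r; apply: (@le_trans _ _ 1); first by apply: exprn_ile1; rewrite ?/e; lra.
  by apply: mulr_ege1; apply: exprn_ege1 => //; rewrite ler1n.
have small' : all_equal_prob R f g h < (e ^+ 12 / 1250) ^+ 12 / 9.
  exact: lt_le_trans small bound.
have opp u v : close_to_opposite_constants e u v ->
    close_to_opposite_constants eps u v.
  by case=> c [? ?]; exists c; split; exact: close_le e_eps _.
have [[?|[?|?]]|[i [d [di [df [dg dh]]]]]] := arrow_polynomial n0 e02 erefl small'.
- by left; left; exact: opp.
- by left; right; left; exact: opp.
- by left; right; right; exact: opp.
- by right; exists i, d; do 3?split => //; exact: close_le e_eps _.
Qed.
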